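(* Let $H$ be a separable complex Hilbert space, $\mathbf{T}\in\mathcal{B}(H)$, $A\in\mathcal{B}(H)^+$, and let $\mathcal{M}=\ker(\mathbf{T}^*A\mathbf{T}-A)$, with $\mathcal{M}\neq\{0\}$. Assume that $\mathcal{M}$ is invariant for $A$ and for $\mathbf{T}$. Then $\mathbf{T}$ has the form $$\mathbf{T}=\begin{pmatrix}N&E\\0&X\end{pmatrix}\quad\text{on }\mathcal{M}\oplus\mathcal{M}^\perp,$$ with $N\in\mathcal{B}(\mathcal{M})$, $E\in\mathcal{B}(\mathcal{M}^\perp,\mathcal{M})$, $X\in\mathcal{B}(\mathcal{M}^\perp)$, such that $N$ is an $A_{|\mathcal{M}}$-isometry and $E^*A_{|\mathcal{M}}N=0$.
   Context: $\mathcal{B}(H)$ is the algebra of bounded linear operators on $H$, $\mathcal{B}(H)^+$ the set of positive (semi-definite) operators, and $\mathcal{B}(K,L)$ the bounded linear operators from $K$ to $L$. $A_{|\mathcal{M}}$ is the restriction of $A$ to the $A$-invariant subspace $\mathcal{M}$, viewed as an operator on $\mathcal{M}$. For a positive operator $B$ on a Hilbert space, a bounded operator $S$ is a $B$-isometry if $S^*BS=B$. *)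

(* Defs.v *)
From HB Require Import structures.
From mathcomp Require Import all_boot all_order all_algebra.
From mathcomp Require Import complex.
From mathcomp Require Import ring.
From mathcomp Require Import all_classical all_reals all_analysis.
Set Implicit Arguments.
Unset Strict Implicit.
Unset Printing Implicit Defensive.
Import Order.TTheory GRing.Theory Num.Theory.
Import numFieldNormedType.Exports.
Local Open Scope classical_set_scope.
Local Open Scope complex_scope.
Local Open Scope ring_scope.

(* The norm of a normed module over R[i] is itself R[i]-valued, so dotp_norm is
   an identity in R[i]; it also makes dotp positive definite. The inner product
   is linear in its first argument. *)
HB.mixin Record NormedModule_isHilbert (R : realType) H
    & CompleteNormedModule R[i] H := {
  dotp : H -> H -> R[i] ;
  dotp_linearl : forall y a x z, dotp (a *: x + z) y = a * dotp x y + dotp z y ;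
  dotpC : forall x y, dotp y x = (dotp x y)^* ;
  dotp_norm : forall x, dotp x x = `|x| ^+ 2 }.

#[short(type="hilbertType")]
HB.structure Definition Hilbert (R : realType) :=
  {H of CompleteNormedModule R[i] H & NormedModule_isHilbert R H}.

Notation "''[' x , y ]" := (dotp x y) : ring_scope.

Section Hilbert.
Variables (R : realType) (H : hilbertType R).
Implicit Types x y z : H.

Let dotp_bilinear : bilinear_for
  (GRing.Scale.Law.clone _ _ ( *%R : R[i] -> R[i] -> R[i]) _)
  (GRing.Scale.Law.clone _ _ (@Num.conj R[i] \; *%R) _)
  (@dotp R H : H -> H -> R[i]).
Proof.
split=> [y a x z|y a x z] /=; first exact: dotp_linearl.
by rewrite dotpC dotp_linearl rmorphD rmorphM/= -!dotpC.
Qed.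
HB.instance Definition _ :=
  bilinear_isBilinear.Build R[i] H H R[i] _ _ (@dotp R H) dotp_bilinear.
HB.instance Definition _ := @isHermitianSesquilinear.Build R[i] H false
  (@Num.conj R[i]) (@dotp R H)
  (fun x y => etrans (dotpC y x) (esym (mul1r _))).

Let dotp_gt0 x : x != 0 -> 0 < '[x, x].
Proof. by move=> x0; rewrite dotp_norm exprn_gt0// normr_gt0. Qed.
HB.instance Definition _ := @isDotProduct.Build R[i] H (@dotp R H) dotp_gt0.

Lemma dotpDl x y z : '[x + y, z] = '[x, z] + '[y, z].
Proof. exact: linearDl. Qed.
Lemma dotpZl a x z : '[a *: x, z] = a * '[x, z].
Proof. exact: linearZl_LR. Qed.
Lemma dotpBl x y z : '[x - y, z] = '[x, z] - '[y, z].
Proof. exact: linearBl. Qed.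
Lemma dotpDr x y z : '[z, x + y] = '[z, x] + '[z, y].
Proof. exact: linearDr. Qed.
Lemma dotpZr a x z : '[z, a *: x] = a^* * '[z, x].
Proof. exact: linearZr_LR. Qed.
Lemma dotpBr x y z : '[z, x - y] = '[z, x] - '[z, y].
Proof. exact: linearBr. Qed.
Lemma dotp0r z : '[z, 0] = 0.
Proof. exact: linear0r. Qed.

(* the projection of x onto the line spanned by y minimises the distance *)
Lemma dotp_proj x y : y != 0 ->
  let a := '[x, y] / '[y, y] in
  `|x - a *: y| ^+ 2 = `|x| ^+ 2 - `|'[x, y]| ^+ 2 / `|y| ^+ 2.
Proof.
move=> y0 a.
have ya : `|y| ^+ 2 != 0 by rewrite expf_neq0// normr_eq0.
have aE : '[x, y] = a * `|y| ^+ 2 by rewrite /a dotp_norm divfK.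
have aEc : ('[x, y])^* = a^* * `|y| ^+ 2.
  by rewrite aE rmorphM/= [X in _ * X]geC0_conj// exprn_ge0.
rewrite normCK -dotp_norm dotpBl !dotpBr !dotpZl !dotpZr (dotpC x y) !dotp_norm.
rewrite aEc aE.
by field; rewrite normr_eq0.
Qed.

Lemma cauchy_schwarz x y : `|'[x, y]| <= `|x| * `|y|.
Proof.
have [->|y0] := eqVneq y 0; first by rewrite dotp0r !normr0 mulr0.
have : 0 <= `|x - ('[x, y] / '[y, y]) *: y| ^+ 2 by rewrite exprn_ge0.
rewrite dotp_proj// subr_ge0 ler_pdivrMr ?exprn_gt0 ?normr_gt0// -exprMn.
by rewrite ler_sqr ?nnegrE ?mulr_ge0.
Qed.

Lemma dotp_continuousl y : continuous (fun x => '[x, y] : R[i]^o).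
Proof.
move=> x; apply/cvgrPdist_lt => e e0.
have k0 : 0 < `|y| + 1 by rewrite ltr_wpDl.
near=> z.
rewrite -dotpBl (le_lt_trans (cauchy_schwarz _ _))//.
apply: (@le_lt_trans _ _ (`|x - z| * (`|y| + 1))).
  by rewrite ler_wpM2l// lerDl.
rewrite -ltr_pdivlMr//.
by near: z; apply: cvgr_dist_lt => //; rewrite divr_gt0.
Unshelve. all: by end_near. Qed.

Lemma dotp_inj x y : (forall z, '[x, z] = '[y, z]) -> x = y.
Proof.
move=> h; apply/eqP; rewrite -subr_eq0 -normr_eq0 -sqrf_eq0 -dotp_norm.
by rewrite dotpBl h subrr.
Qed.
End Hilbert.

Definition separable_space (T : topologicalType) :=
  exists D : set T, countable D /\ dense D.

Record closedSubspace (R : realType) (H : hilbertType R) := ClosedSubspace {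
  cs_pred : {pred H} ;
  cs_submod : submod_closed cs_pred ;
  cs_closed : closed [set x | x \in cs_pred] }.
Canonical cs_predType (R : realType) (H : hilbertType R) :=
  PredType (@cs_pred R H).

Section SubHilbert.
Variables (R : realType) (H : hilbertType R) (M : closedSubspace H).

HB.instance Definition _ :=
  GRing.isSubmodClosed.Build R[i] H (cs_pred M) (cs_submod M).

Record subsp : predArgType :=
  Subsp { subsp_val :> H ; subspP : subsp_val \in cs_pred M }.
HB.instance Definition _ := [isSub for subsp_val].
HB.instance Definition _ := [Choice of subsp by <:].
HB.instance Definition _ := [SubChoice_isSubLmodule of subsp by <:].

Let norm (x : subsp) : R[i] := `|subsp_val x|.
Let normD x y : norm (x + y) <= norm x + norm y.
Proof. exact: ler_normD. Qed.
Let normZ l x : norm (l *: x) = `|l| * norm x.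
Proof. exact: normrZ. Qed.
Let norm0 x : norm x = 0 -> x = 0.
Proof. by move=> /normr0_eq0 x0; apply/val_inj. Qed.
HB.instance Definition _ := Lmodule_isNormed.Build R[i] subsp normD normZ norm0.

Let subsp_complete (F : set_system subsp) :
  ProperFilter F -> cauchy F -> cvg F.
Proof.
move=> FF /cauchyP Fc.
pose G := subsp_val @ F.
have Gc : cvg G.
  apply: cauchy_cvg; apply/cauchyP => e e0.
  have [x xF] := Fc e e0; exists (subsp_val x).
  by apply: (@filterS _ F _ (ball x e)) => // z; rewrite -!ball_normE.
have lM : lim G \in cs_pred M.
  apply: (@closed_cvg _ _ F _ subsp_val [set x | x \in cs_pred M]).
  - exact: cs_closed.
  - by apply: nearW => x; exact: subspP.
  - exact: Gc.
apply/cvg_ex; exists (Subsp lM); apply/cvgrPdist_lt => e e0.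
move/cvgrPdist_lt : Gc => /(_ e e0).
exact: filterS.
Qed.
HB.instance Definition _ := Uniform_isComplete.Build subsp subsp_complete.

Definition subsp_dotp (x y : subsp) : R[i] := '[(x : H), (y : H)].
Let subsp_dotp_linearl y a x z :
  subsp_dotp (a *: x + z) y = a * subsp_dotp x y + subsp_dotp z y.
Proof. exact: dotp_linearl. Qed.
Let subsp_dotpC x y : subsp_dotp y x = (subsp_dotp x y)^*.
Proof. exact: dotpC. Qed.
Let subsp_dotp_norm x : subsp_dotp x x = `|x| ^+ 2.
Proof. exact: dotp_norm. Qed.
HB.instance Definition _ := NormedModule_isHilbert.Build R subsp
  subsp_dotp_linearl subsp_dotpC subsp_dotp_norm.
End SubHilbert.

Section Orthogonal.
Variables (R : realType) (H : hilbertType R) (M : closedSubspace H).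

Definition orth_pred : {pred H} :=
  fun x => `[< forall y : H, y \in M -> '[x, y] = 0 >].

Let orth_submod : submod_closed orth_pred.
Proof.
split=> [|a x z /asboolP xM /asboolP zM]; apply/asboolP => y yM.
  by rewrite -(scale0r 0) dotpZl mul0r.
by rewrite dotp_linearl xM// zM// mulr0 addr0.
Qed.

Let orth_closed : closed [set x | x \in orth_pred].
Proof.
rewrite (_ : [set x | x \in orth_pred] =
  \bigcap_(y in [set y | y \in M]) [set x | '[x, y] = 0]).
  apply: closed_bigI => y _.
  have /continuous_closedP := @dotp_continuousl R H y.
  move=> /(_ [set 0]); apply; apply: accessible_closed_set1.
  by apply: hausdorff_accessible; exact: norm_hausdorff.
by apply/seteqP; split=> [x /asboolP xM y /= /xM//|x xM]; apply/asboolP => y /xM.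
Qed.

Definition orth := ClosedSubspace orth_submod orth_closed.

Lemma orthP x : reflect (forall y : H, y \in M -> '[x, y] = 0) (x \in orth).
Proof. exact: asboolP. Qed.

Let near_min x : exists m : nat -> H, forall n, m n \in M /\
  forall v, v \in M -> `|'[x - m n, v]| <= n.+1%:R^-1 * `|v|.
Proof.
have MS := cs_submod M.
have M0 : 0 \in M by case: MS.
have MD a u v : u \in M -> v \in M -> a *: u + v \in M by move=> uM vM; apply MS.2.
pose q (m : H) : R := complex.Re (`|x - m| ^+ 2).
have qE m : `|x - m| ^+ 2 = (q m)%:C.
  by rewrite /q RRe_real// ger0_real// exprn_ge0.
have q0 m : 0 <= q m by rewrite -lecR -qE exprn_ge0.
pose D := [set q m | m in [set m | m \in M]].
have D0 : has_inf D.
  by split; [exists (q 0), 0|exists 0 => _ [m _ <-]].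
suff /choice[m mP] : forall n : nat, exists m : H, m \in M /\
  forall v, v \in M -> `|'[x - m, v]| <= n.+1%:R^-1 * `|v| by exists m.
move=> n.
have en : (0 : R) < (n.+1%:R^-1) ^+ 2 by rewrite exprn_gt0// invr_gt0.
have [_ [m mM <-] mlt] := inf_adherent en D0.
exists m; split=> // v vM.
have [->|v0] := eqVneq v 0; first by rewrite dotp0r !normr0 mulr0.
have := dotp_proj (x - m) v0; set a := _ / _ => /= pE.
have avM : a *: v + m \in M by exact: MD.
have : inf D <= q (a *: v + m) by apply: ge_inf; [case: D0|exists (a *: v + m)].
rewrite -lecR -qE opprD addrA addrAC pE qE lerBrDr -lerBrDl => le1.
have le2 : `|'[x - m, v]| ^+ 2 / `|v| ^+ 2 <= n.+1%:R^-1 ^+ 2.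
  have -> : (n.+1%:R^-1 ^+ 2 : R[i]) = (n.+1%:R^-1 ^+ 2 : R)%:C.
    by rewrite rmorphXn fmorphV rmorph_nat.
  apply: (le_trans le1); rewrite -rmorphB lecR lerBlDl; exact: ltW.
move: le2; rewrite ler_pdivrMr ?exprn_gt0 ?normr_gt0// -exprMn.
by rewrite ler_sqr ?nnegrE ?mulr_ge0// invr_ge0.
Qed.

Let natSinv_lt (e : R[i]) : 0 < e -> \forall n \near \oo, n.+1%:R^-1 < e.
Proof.
move=> e0; have eE : e = (complex.Re e)%:C by rewrite RRe_real// gtr0_real.
have e0' : 0 < complex.Re e by rewrite -ltcR -eE.
have := near_infty_natSinv_lt (PosNum e0'); apply: filterS => n /=.
by rewrite -ltcR -eE fmorphV rmorph_nat.
Qed.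

Lemma orth_decomp x : exists m p : H, [/\ m \in M, p \in orth & x = m + p].
Proof.
have [m mP] := near_min x.
have MB u v : u \in M -> v \in M -> u - v \in M.
  by move=> uM vM; rewrite -scaleN1r addrC; apply: (cs_submod M).2.
have dm n k : `|m n - m k| <= n.+1%:R^-1 + k.+1%:R^-1.
  have [->|mnk] := eqVneq (m n - m k) 0.
    by rewrite normr0 addr_ge0// invr_ge0.
  have wM : m n - m k \in M by apply: MB; [case: (mP n)|case: (mP k)].
  rewrite -(ler_pM2r (_ : 0 < `|m n - m k|)) ?normr_gt0//.
  have mE : m n - m k = (x - m k) - (x - m n).
    by rewrite opprB [RHS]addrC addrA subrK.
  rewrite -expr2 -dotp_norm.
  have -> : '[m n - m k, m n - m k] =
      '[x - m k, m n - m k] - '[x - m n, m n - m k].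
    by rewrite -dotpBl -mE.
  rewrite -[leLHS]ger0_norm; last first.
    by rewrite -dotpBl -mE dotp_norm exprn_ge0.
  rewrite (le_trans (ler_normB _ _))// mulrDl addrC.
  by apply: lerD; [exact: (mP n).2|exact: (mP k).2].
have mc : cvg (m @ \oo).
  apply: cauchy_cvg; apply/cauchyP => e e0.
  have e2 : 0 < e / 2 by rewrite divr_gt0.
  have [N _ NP] := natSinv_lt e2.
  exists (m N); exists N => // n /= Nn.
  rewrite -ball_normE /= (le_lt_trans (dm _ _))// (splitr e).
  by rewrite ltrD//; apply: NP => /=.
pose l := lim (m @ \oo).
have lM : l \in M.
  apply: (@closed_cvg _ _ \oo _ m [set x | x \in cs_pred M]).
  - exact: cs_closed.
  - by apply: nearW => n; case: (mP n).
  - exact: mc.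
exists l, (x - l); split=> //; last by rewrite addrC subrK.
apply/orthP => y yM; apply/eqP; rewrite -normr_le0.
apply/ler_addgt0Pl => e e0; rewrite addr0.
have k0 : 0 < `|y| + 1 by rewrite ltr_wpDl.
pose d := e / 2 / (`|y| + 1).
have d0 : 0 < d by rewrite !divr_gt0.
near \oo => n.
rewrite -[x](subrK (m n)) -addrA dotpDl.
rewrite (le_trans (ler_normD _ _))//.
apply: (@le_trans _ _ (d * (`|y| + 1) + d * (`|y| + 1))); last first.
  by rewrite /d divfK ?gt_eqF// -splitr.
apply: lerD.
- rewrite (le_trans ((mP n).2 _ yM))//.
  apply: ler_pM; rewrite ?invr_ge0// ?lerDl//.
  by apply: ltW; near: n; exact: natSinv_lt.
- rewrite (le_trans (cauchy_schwarz _ _))//.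
  apply: ler_pM; rewrite ?lerDl//.
  by apply: ltW; near: n; exact: cvgr_distC_lt.
Unshelve. all: by end_near. Qed.
End Orthogonal.

Section BoundedOperators.
Variable R : realType.
Implicit Types K L G : hilbertType R.

Record bop K L := Bop {
  bop_fun :> {linear K -> L} ;
  bop_bounded : bounded_near bop_fun (nbhs (0 : K)) }.

Lemma bop_ext K L (S T : bop K L) : S =1 T -> S = T.
Proof.
case: S T => [[s [[sD] [sZ]]] Sb] [[t [[tD] [tZ]]] Tb] /= /funext st.
move: st sD sZ Sb tD tZ Tb => -> sD sZ Sb tD tZ Tb.
have -> : sD = tD by exact: Prop_irrelevance.
have -> : sZ = tZ by exact: Prop_irrelevance.
by congr Bop; exact: Prop_irrelevance.
Qed.

Lemma bop_cont K L (T : bop K L) : continuous T.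
Proof. by apply/linear_bounded_continuous; exact: bop_bounded. Qed.

Lemma continuous_bop K L (f : {linear K -> L}) :
  continuous f -> bounded_near f (nbhs (0 : K)).
Proof. by move/linear_bounded_continuous. Qed.

Lemma bop_lip K L (T : bop K L) :
  exists2 c : R[i], 0 <= c & forall x, `|T x| <= c * `|x|.
Proof.
have /linear_boundedP/pinfty_ex_gt0[c c0 cP] := bop_bounded T.
by exists c => //; exact: ltW.
Qed.

Let lin_bounded K L (f : {linear K -> L}) (c : R[i]) :
  0 <= c -> (forall x, `|f x| <= c * `|x|) -> bounded_near f (nbhs (0 : K)).
Proof.
move=> c0 fc; apply/linear_boundedP; near=> r => x.
rewrite (le_trans (fc x))// ler_wpM2r//; near: r.
by apply: nbhs_pinfty_ge; exact: ger0_real.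
Unshelve. all: by end_near. Qed.

Let bop0_bounded K L : bounded_near (\0 : {linear K -> L}) (nbhs (0 : K)).
Proof. by apply: continuous_bop => x; exact: cvg_cst. Qed.
Definition bop0 K L : bop K L := Bop (@bop0_bounded K L).

Let bop_sub_bounded K L (S T : bop K L) :
  bounded_near (S \- T : {linear K -> L}) (nbhs (0 : K)).
Proof. by apply: continuous_bop => x; apply: cvgB; exact: bop_cont. Qed.
Definition bop_sub K L (S T : bop K L) : bop K L := Bop (bop_sub_bounded S T).

Let bop_comp_bounded K L G (S : bop L G) (T : bop K L) :
  bounded_near (S \o T : {linear K -> G}) (nbhs (0 : K)).
Proof.
by apply: continuous_bop => x; apply: continuous_comp; exact: bop_cont.
Qed.
Definition bop_comp K L G (S : bop L G) (T : bop K L) : bop K G :=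
  Bop (bop_comp_bounded S T).

Section Kernel.
Variables (K L : hilbertType R) (T : bop K L).
Let ker_pred : {pred K} := fun x => T x == 0.
Let ker_submod : submod_closed ker_pred.
Proof.
split=> [|a x y /eqP xK /eqP yK]; apply/eqP; first exact: linear0.
by rewrite linearP xK yK scaler0 addr0.
Qed.
Let ker_closed : closed [set x | x \in ker_pred].
Proof.
rewrite (_ : [set x | _] = T @^-1` [set 0]).
  have /continuous_closedP := @bop_cont K L T; apply; apply: accessible_closed_set1.
  by apply: hausdorff_accessible; exact: norm_hausdorff.
by apply/seteqP; split=> x /eqP.
Qed.
Definition bop_ker := ClosedSubspace ker_submod ker_closed.
Lemma bop_kerP x : reflect (T x = 0) (x \in bop_ker).
Proof. exact: eqP. Qed.
End Kernel.

(* The Hilbert space adjoint, obtained from the Riesz representation theorem. *)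
Section Adjoint.
Variables (K L : hilbertType R) (T : bop K L).

Let riesz (y : L) : exists z : K, forall x, '[T x, y] = '[x, z].
Proof.
pose N : {pred K} := fun x => '[T x, y] == 0.
have Ns : submod_closed N.
  split=> [|a x z /eqP xK /eqP zK]; apply/eqP.
    by rewrite linear0 -(scale0r 0) dotpZl mul0r.
  by rewrite linearP dotp_linearl xK zK mulr0 addr0.
have Nc : closed [set x | x \in N].
  rewrite (_ : [set x | _] = T @^-1` [set z | '[z, y] = 0]).
    have /continuous_closedP := @bop_cont K L T; apply.
    have /continuous_closedP := @dotp_continuousl R L y.
    move=> /(_ [set 0]); apply; apply: accessible_closed_set1.
    by apply: hausdorff_accessible; exact: norm_hausdorff.
  by apply/seteqP; split=> x /eqP.
pose M := ClosedSubspace Ns Nc.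
have [MT|] := pselect (forall x, '[T x, y] = 0).
  by exists 0 => x; rewrite MT dotp0r.
move=> /existsNP[x0 /eqP x00].
have [m [p [/eqP mM /orthP pM x0E]]] := orth_decomp M x0.
have p0 : '[T p, y] != 0.
  by move: x00; rewrite x0E linearD dotpDl mM add0r.
have pp0 : '[p, p] != 0.
  rewrite dotp_norm expf_neq0// normr_eq0; apply: contraNneq p0 => ->.
  by rewrite linear0 -(scale0r 0) dotpZl mul0r.
pose a := '[T p, y] / '[p, p].
exists (a^* *: p) => x; rewrite dotpZr conjCK.
have : '[p, '[T x, y] *: p - '[T p, y] *: x] = 0.
  apply: pM; apply/eqP.
  have -> : T ('[T x, y] *: p - '[T p, y] *: x) =
      '[T x, y] *: T p - '[T p, y] *: T x by rewrite linearB !linearZ.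
  by rewrite dotpBl !dotpZl mulrC subrr.
move/(congr1 (@Num.conj R[i])); rewrite -dotpC conjC0 dotpBl !dotpZl.
by move/eqP; rewrite subr_eq0 => /eqP h; rewrite /a mulrAC -h mulfK.
Qed.

Lemma bop_adj_exists : exists S : bop L K, forall x y, '[T x, y] = '[x, S y].
Proof.
have /choice[S SP] := riesz.
have Sl : linear S.
  move=> a u v; apply: dotp_inj => z; apply: (can_inj conjCK).
  by rewrite -!dotpC -SP dotpDr dotpZr !SP dotpDr dotpZr.
pose Sm := GRing.isLinear.Build R[i] L K *:%R S Sl.
pose SL : {linear L -> K} := HB.pack S Sm.
have [c c0 cP] := bop_lip T.
have Sb : bounded_near SL (nbhs (0 : L)).
  apply: (@lin_bounded _ _ SL c c0) => y /=.
  have [->|Sy0] := eqVneq (S y) 0; first by rewrite normr0 mulr_ge0.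
  rewrite -(ler_pM2r (_ : 0 < `|S y|)) ?normr_gt0//.
  rewrite -expr2 -dotp_norm -SP.
  rewrite -[leLHS]ger0_norm; last by rewrite SP dotp_norm exprn_ge0.
  rewrite (le_trans (cauchy_schwarz _ _))// mulrAC ler_wpM2r//.
by exists (Bop Sb).
Qed.

Definition bop_adj : bop L K := projT1 (cid bop_adj_exists).
Lemma bop_adjE x y : '[T x, y] = '[x, bop_adj y].
Proof. exact: (projT2 (cid bop_adj_exists)). Qed.
End Adjoint.

Section Restriction.
Variables (H : hilbertType R) (M : closedSubspace H) (A : bop H H).
Definition invariant_subspace := forall x : H, x \in M -> A x \in M.
Hypothesis AM : invariant_subspace.
Definition restr_fun (x : subsp M) : subsp M := Subsp (AM (subspP x)).
Let restr_linear : linear restr_fun.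
Proof. by move=> a x y; apply/val_inj; rewrite /= linearP. Qed.
HB.instance Definition _ :=
  GRing.isLinear.Build R[i] (subsp M) (subsp M) *:%R restr_fun restr_linear.
Let restr_bounded : bounded_near restr_fun (nbhs (0 : subsp M)).
Proof.
have [c c0 cP] := bop_lip A.
by apply: (@lin_bounded _ _ restr_fun c c0) => x; exact: cP.
Qed.
Definition bop_restr : bop (subsp M) (subsp M) := Bop restr_bounded.
End Restriction.
Definition positive_op (H : hilbertType R) (A : bop H H) :=
  forall x : H, 0 <= '[A x, x].

Definition op_isometry (H : hilbertType R) (B S : bop H H) :=
  bop_comp (bop_adj S) (bop_comp B S) = B.

(* T = ((T11, T12), (T21, T22)) with respect to H = M (+) orth M, where
   orth_decomp provides the decomposition of H. *)
Definition block_form (H : hilbertType R) (M : closedSubspace H) (T : bop H H)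
    (T11 : bop (subsp M) (subsp M)) (T12 : bop (subsp (orth M)) (subsp M))
    (T21 : bop (subsp M) (subsp (orth M)))
    (T22 : bop (subsp (orth M)) (subsp (orth M))) :=
  forall (x : subsp M) (y : subsp (orth M)),
    T (subsp_val x + subsp_val y) =
      subsp_val (T11 x + T12 y) + subsp_val (T21 x + T22 y).
End BoundedOperators.

(* Main.v *)
Require Import Defs.
From HB Require Import structures.
From mathcomp Require Import all_boot all_order all_algebra.
From mathcomp Require Import complex.
From mathcomp Require Import all_classical all_reals all_analysis.
Import Order.TTheory GRing.Theory Num.Theory.
Import numFieldNormedType.Exports.
Local Open Scope classical_set_scope.
Local Open Scope complex_scope.
Local Open Scope ring_scope.

(** Let [J] and [J'] be the inclusions of [M] and of its orthogonal complement
    [M'] into [H]; their adjoints are the two orthogonal projections, and the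
    entries of [T] are [N = J* T J], which is the restriction of [T],
    [E = J* T J'] and [X = J'* T J']. The lower left entry vanishes because
    [T M] is contained in [M].

    Everything else comes from testing [T* A T x = A x], which holds for [x] in
    [M], against vectors [z] of [H]: it says
    [<T z, A T x> = <z, T* A T x> = <z, A x>].
    For [z] in [M], both [T z = N z] and [A T x = A N x] live in [M], so this is
    the isometry identity for [N]. For [z] in [M'], the left-hand side is
    [<E z, A N x>], because [A T x] lies in [M] and so sees only the [M]-component
    [E z] of [T z], while the right-hand side is [0] because [A x] lies in [M]. *)

Lemma dotp_injr {R : realType} {H : hilbertType R} (x y : H) :
  (forall z, '[z, x] = '[z, y]) -> x = y.
Proof. by move=> xy; apply: dotp_inj => z; rewrite dotpC xy -dotpC. Qed.

Section Inclusion.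
Variables (R : realType) (H : hilbertType R) (M : closedSubspace H).

Lemma subsp_val_bounded :
  bounded_near (\val : {linear subsp M -> H}) (nbhs (0 : subsp M)).
Proof.
apply/linear_boundedP; near=> r => x.
by rewrite ler_peMl//; near: r; exact: nbhs_pinfty_ge.
Unshelve. all: by end_near. Qed.

Definition inclusion : bop (subsp M) H := Bop subsp_val_bounded.

Definition projection : bop H (subsp M) := bop_adj inclusion.

Lemma dotp_projection (u : subsp M) (x : H) :
  '[u, projection x] = '[subsp_val u, x].
Proof. by rewrite -bop_adjE. Qed.
End Inclusion.
Arguments inclusion {R H} M.
Arguments projection {R H} M.

Section Projections.
Variables (R : realType) (H : hilbertType R) (M : closedSubspace H).

(** The vectors [m] and [p] of a decomposition [x = m + p] are the two
    projections of [x], since the other summand is invisible to inner products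
    with the subspace. *)
Lemma projectionD (x : H) :
  x = subsp_val (projection M x) + subsp_val (projection (orth M) x).
Proof.
have [m [p [mM pM xE]]] := orth_decomp M x.
have -> : projection M x = Subsp mM.
  apply: dotp_injr => u; rewrite dotp_projection xE dotpDr [X in _ + X]dotpC.
  by move/orthP : pM => /(_ _ (subspP u)) ->; rewrite conjC0 addr0.
have -> : projection (orth M) x = Subsp pM.
  apply: dotp_injr => u; rewrite dotp_projection xE dotpDr.
  by have /orthP -> := subspP u; rewrite ?add0r.
by [].
Qed.

Lemma block_form_invariant (T : bop H H) (TM : invariant_subspace M T) :
  block_form T (bop_restr TM)
    (bop_comp (projection M) (bop_comp T (inclusion (orth M))))
    (bop0 (subsp M) (subsp (orth M)))
    (bop_comp (projection (orth M)) (bop_comp T (inclusion (orth M)))).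
Proof.
by move=> x y; rewrite linearD [T (subsp_val y)]projectionD /= add0r addrA.
Qed.
End Projections.

Theorem theorem4p5 (R : realType) (H : hilbertType R)
    (sepH : separable_space H) (T A : bop H H) (posA : positive_op A)
    (M : closedSubspace H)
    (defM : M = bop_ker (bop_sub (bop_comp (bop_adj T) (bop_comp A T)) A))
    (M0 : [set x | x \in M] <> [set 0 : H])
    (AM : invariant_subspace M A) (TM : invariant_subspace M T) :
  exists (N : bop (subsp M) (subsp M))
         (E : bop (subsp (orth M)) (subsp M))
         (X : bop (subsp (orth M)) (subsp (orth M))),
    [/\ block_form T N E (bop0 (subsp M) (subsp (orth M))) X,
        op_isometry (bop_restr AM) N &
        bop_comp (bop_adj E) (bop_comp (bop_restr AM) N) =
          bop0 (subsp M) (subsp (orth M))].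
Proof.
have TAT (x : subsp M) (z : H) :
    '[T z, A (T (subsp_val x))] = '[z, A (subsp_val x)].
  have := subspP x; rewrite [X in _ \in cs_pred X]defM => /bop_kerP /eqP.
  by rewrite subr_eq0 bop_adjE => /eqP /= ->.
exists (bop_restr TM), (bop_comp (projection M) (bop_comp T (inclusion _))),
  (bop_comp (projection (orth M)) (bop_comp T (inclusion _))).
split; first exact: block_form_invariant.
- apply: bop_ext => x; apply: dotp_injr => z.
  by rewrite -[LHS]bop_adjE; exact: TAT.
- apply: bop_ext => x; apply: dotp_injr => y.
  rewrite -[LHS]bop_adjE dotp0r dotpC dotp_projection -dotpC /= TAT.
  have /orthP := subspP y; apply; exact: AM (subspP x).
Qed.
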